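(* The maximum number of edges in an $n$-vertex graph $G$ with $\pi(G)\leq c$ is $(c-1)n-\binom{c}{2}$.
   Context: All graphs are simple, finite and undirected. A path in $G$ is a sequence $v_1,\dots,v_t$ of pairwise distinct vertices with $v_iv_{i+1}\in E(G)$ for all $1\le i\le t-1$. A $k$-colouring of $G$ is a function assigning one of $k$ colours to each vertex of $G$. A path $v_1,\dots,v_{2t}$ ($t\ge 1$) is repetitively coloured by a colouring $f$ if $f(v_i)=f(v_{t+i})$ for all $i\in\{1,\dots,t\}$. $\pi(G)$ is the minimum $k$ such that $G$ has a $k$-colouring for which no path of $G$ is repetitively coloured.
   Formalization: The theorem assumes c ≥ 1 and n ≥ c−1; for n < c−1 the claimed formula is false, since the complete graph on n vertices has π = n ≤ c and more edges than the formula (e.g. n = 2, c = 4: one edge, but the formula gives 0). *)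

(* Defs.v *)
From mathcomp Require Import all_boot.
From mathcomp Require Import boolp.
Set Implicit Arguments.
Unset Strict Implicit.
Unset Printing Implicit Defensive.

Record sgraph := SGraph {
  vertex :> finType;
  adj : rel vertex;
  adj_sym : symmetric adj;
  adj_irrefl : irreflexive adj }.

Definition edges (G : sgraph) : {set {set G}} :=
  [set A | [exists x : G, exists y : G, adj x y && (A == [set x; y])]].

Definition is_path (G : sgraph) (p : seq G) : bool := uniq p && sorted (@adj G) p.

(* Vertices are numbered from 0: the indices i and t + i of the tuple, for
   i < t, are [lshift t i] and [rshift t i]. *)
Definition repetitively_coloured (G : sgraph) (k : nat) (f : {ffun G -> 'I_k})
    (t : nat) (p : (t + t).-tuple G) : Prop :=
  forall i : 'I_t, f (tnth p (lshift t i)) = f (tnth p (rshift t i)).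

Definition nonrepetitive (G : sgraph) (k : nat) (f : {ffun G -> 'I_k}) : Prop :=
  forall (t : nat) (p : (t + t).-tuple G),
    0 < t -> is_path p -> ~ repetitively_coloured f p.

Definition nonrep_colourable (G : sgraph) (k : nat) : Prop :=
  exists f : {ffun G -> 'I_k}, nonrepetitive f.

Lemma nonrep_colourable_card (G : sgraph) : nonrep_colourable G #|G|.
Proof.
exists [ffun x => enum_rank x] => t p t_gt0 /andP[p_uniq _].
move=> /(_ (Ordinal t_gt0)); rewrite !ffunE => /enum_rank_inj/(tuple_uniqP p p_uniq)/eqP.
by rewrite eq_lrshift.
Qed.

Lemma ex_nonrep_colourable (G : sgraph) : exists k, `[< nonrep_colourable G k >].
Proof. by exists #|G|; apply/asboolP/nonrep_colourable_card. Qed.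

(* The nonrepetitive chromatic number, usually written pi(G). *)
Definition nonrep_chi (G : sgraph) : nat := ex_minn (ex_nonrep_colourable G).

Definition is_maximum (P : nat -> Prop) (m : nat) : Prop :=
  P m /\ forall k, P k -> k <= m.

(* Main.v *)
Require Import Defs.
From mathcomp Require Import all_boot.
From mathcomp Require Import boolp zify.
Set Implicit Arguments.
Unset Strict Implicit.
Unset Printing Implicit Defensive.

(** Upper bound.  A nonrepetitive colouring is proper and has no two-coloured
    path on four vertices, so any two colour classes span a star forest: every
    edge has an end, a leaf, with no other neighbour in the colour of the
    opposite end.  Orienting each edge away from one of its leaves and sending
    the arc [(x, y)] to [(x, f y)] embeds the edges into the set of pairs
    (vertex, used colour other than its own), which has [n * (s - 1)] elements
    when [s] colours are used ([leaf_arcs_inj], [foreign_pairs_card]).  Each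
    pair of used colours forces one element outside the image, since a forest
    has fewer edges than vertices ([missed_pair]); hence there are at most
    [(s - 1) * n - 'C(s, 2)] edges.  This quantity is nondecreasing in [s] up
    to [s = n + 1], so using fewer than [c] colours does not help.

    Lower bound.  Take [c - 1] vertices adjacent to every other vertex, the
    rest being independent.  Give the dominating vertices private colours and
    the independent set one further colour.  In a repetitively coloured path
    every vertex shares its colour with another one, so the whole path would
    lie in the independent set. *)

(** * Star colourings *)

Section StarColouring.

Variables (G : sgraph) (K : finType) (f : G -> K).

Definition star_colouring : Prop :=
  (forall x y, adj x y -> f x != f y) /\
  (forall a b c d : G, is_path [:: a; b; c; d] ->
     ~ (f a = f c /\ f b = f d)).

(** [x] is a leaf, attached to [y], of the graph spanned by the colours of [x]
    and [y]. *)
Definition leaf (x y : G) : bool :=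
  adj x y && [forall z, adj x z && (f z == f y) ==> (z == y)].

(** One orientation of each edge, starting from a leaf; an edge whose two ends
    are leaves is oriented by an arbitrary linear order on the vertices. *)
Definition leaf_arcs : {set G * G} :=
  [set p | leaf p.1 p.2 &&
           (leaf p.2 p.1 ==> (enum_rank p.1 < enum_rank p.2))].

Definition foreign_pairs : {set G * K} :=
  [set p | (p.2 \in f @: [set: G]) && (p.2 != f p.1)].

Lemma leaf_uniq x y z : leaf x y -> adj x z -> f z = f y -> z = y.
Proof.
by case/andP=> _ /forallP/(_ z)/implyP h xz fzy; apply/eqP/h; rewrite xz fzy eqxx.
Qed.

Lemma leaf_arcs_adj x y : (x, y) \in leaf_arcs -> adj x y.
Proof. by rewrite inE => /andP[/andP[]]. Qed.

Lemma leaf_arcs_asym x y : (x, y) \in leaf_arcs -> (y, x) \notin leaf_arcs.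
Proof.
rewrite !inE /= => /andP[xy]; case yx: (leaf y x) => //=.
by rewrite xy /= => lt_xy; rewrite -leqNgt ltnW.
Qed.

(** Arcs leaving [x] towards a given colour coincide, because [x] is a leaf for
    that colour. *)
Lemma leaf_arcs_inj : {in leaf_arcs &, injective (fun p => (p.1, f p.2))}.
Proof.
move=> [x y] [x' y']; rewrite !inE /= => /andP[xy _] /andP[/andP[xy' _] _].
by case=> eq_x eq_f; subst x'; rewrite (leaf_uniq xy xy' (esym eq_f)).
Qed.

Hypothesis f_star : star_colouring.

(** Further neighbours [z] of [x] and [w] of [y] would give the two-coloured
    path [w, y, x, z]. *)
Lemma star_leaf x y : adj x y -> leaf x y || leaf y x.
Proof.
have [f_proper f_P4] := f_star.
move=> xy; have yx : adj y x by rewrite adj_sym.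
rewrite /leaf xy yx /=; apply/norP => -[].
case/forallPn=> z; rewrite negb_imply => /andP[/andP[xz /eqP fz] z_y].
case/forallPn=> w; rewrite negb_imply => /andP[/andP[yw /eqP fw] w_x].
have fxy := f_proper _ _ xy.
have neq u v : f u != f v -> u != v by apply: contraNneq => ->.
apply: (f_P4 w y x z) => //; rewrite /is_path /= !inE /= !negb_or.
rewrite (adj_sym w) yw yx xz w_x (eq_sym y z) z_y !andbT /=.
by rewrite !neq // ?fw ?fz // eq_sym.
Qed.

Lemma leaf_arcs_total x y :
  adj x y -> ((x, y) \in leaf_arcs) || ((y, x) \in leaf_arcs).
Proof.
move=> xy; have := star_leaf xy; rewrite !inE /=.
have : enum_rank x != enum_rank y :> nat.
  apply: contraTneq xy => /ord_inj/enum_rank_inj ->.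
  by rewrite adj_irrefl.
by case: (leaf x y); case: (leaf y x) => //=; rewrite ?orbT ?andbT // neq_ltn.
Qed.

Lemma leaf_arcs_card : #|leaf_arcs| = #|edges G|.
Proof.
rewrite -(card_in_imset (f := fun p : G * G => [set p.1; p.2])).
  apply: eq_card => A; apply/imsetP/idP.
    case=> -[x y] /leaf_arcs_adj xy ->; rewrite inE.
    by apply/existsP; exists x; apply/existsP; exists y; rewrite xy eqxx.
  rewrite inE => /existsP[x /existsP[y /andP[xy /eqP->]]].
  case/orP: (leaf_arcs_total xy) => h; first by exists (x, y).
  by exists (y, x) => //=; rewrite setUC.
move=> [x y] [x' y'] /= xy xy' /setP eqs.
have x_y' : x != y by apply: contraTneq (leaf_arcs_adj xy) => ->; rewrite adj_irrefl.
have := eqs x; have := eqs y; rewrite !inE !eqxx orbT /=.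
move=> /esym/orP[]/eqP ey /esym/orP[]/eqP ex; subst => //.
- by rewrite eqxx in x_y'.
- by rewrite (negPf (leaf_arcs_asym xy)) in xy'.
by rewrite eqxx in x_y'.
Qed.

Lemma leaf_arcs_foreign p : p \in leaf_arcs -> (p.1, f p.2) \in foreign_pairs.
Proof.
case: p => x y /leaf_arcs_adj xy; rewrite inE /= imset_f ?inE //= eq_sym.
exact: f_star.1.
Qed.

(** An arc [(x, y)] between the two colours leaves [(y, f x)] unused, since
    [(y, f x)] could only come from the reverse arc; with no arc between the two
    colours, every pair on them is unused. *)
Lemma missed_pair u v :
  f u != f v ->
  exists2 p, p \in foreign_pairs :\: [set (q.1, f q.2) | q in leaf_arcs] &
             [set f p.1; p.2] = [set f u; f v].
Proof.
move=> fuv; set I := imset _ _.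
have unused x y : (x, y) \in leaf_arcs ->
    (y, f x) \in foreign_pairs :\: I.
  move=> xy; rewrite inE [_ \in foreign_pairs]inE /= imset_f ?inE //=.
  rewrite (f_star.1 _ _ (leaf_arcs_adj xy)) andbT.
  apply/imsetP => -[[y' x'] yx' /= [ey fx]]; subst y'.
  have /andP[leaf_yx' _] : leaf y x' && (leaf x' y ==> (enum_rank y < enum_rank x')).
    by rewrite inE in yx'.
  have ex : x = x'.
    by apply: (leaf_uniq leaf_yx') fx; rewrite adj_sym leaf_arcs_adj.
  by move: (leaf_arcs_asym xy); rewrite ex yx'.
case: (boolP ((u, f v) \in I)) => [/imsetP[[u' y] uy /= [eu ->]]|uv].
  by subst u'; exists (y, f u); [exact: unused | rewrite /= setUC].
exists (u, f v) => //; rewrite inE uv inE /= imset_f ?inE //.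
by rewrite eq_sym.
Qed.

Lemma foreign_pairs_card :
  #|foreign_pairs| = #|G| * (#|f @: [set: G]| - 1).
Proof.
rewrite -sum1dep_card -(pair_big_dep xpredT
  (fun x j => (j \in f @: [set: G]) && (j != f x)) (fun _ _ => 1)) /=.
rewrite -sum_nat_const; apply: eq_bigr => x _.
rewrite sum1dep_card (cardsD1 (f x) (f @: _)) imset_f ?inE // addKn.
by apply: eq_card => j; rewrite !inE andbC.
Qed.

(** The map [p |-> {f p.1, p.2}] takes the unused pairs onto the pairs of used
    colours. *)
Lemma star_colouring_edges :
  #|edges G| + 'C(#|f @: [set: G]|, 2) <= #|G| * (#|f @: [set: G]| - 1).
Proof.
rewrite -foreign_pairs_card -leaf_arcs_card -(card_in_imset leaf_arcs_inj).
set I := imset _ _; set S := f @: _.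
have sub : I \subset foreign_pairs.
  by apply/subsetP => _ /imsetP[p /leaf_arcs_foreign ? ->].
rewrite -(cardsID I foreign_pairs) (setIidPr sub) leq_add2l -cards_draws.
apply: leq_trans (leq_imset_card (fun p : G * K => [set f p.1; p.2]) _).
apply/subset_leq_card/subsetP => B; rewrite inE => /andP[BS /cards2P[i [j [ij eB]]]].
have [iS jS] : i \in S /\ j \in S.
  by split; apply: (subsetP BS); rewrite eB !inE eqxx ?orbT.
case/imsetP: iS => u _ ei; case/imsetP: jS => v _ ej.
have [|p p_missed eq_p] := @missed_pair u v; first by rewrite -ei -ej.
by apply/imsetP; exists p => //; rewrite eB eq_p ei ej.
Qed.

End StarColouring.

Lemma nonrepetitive_star (G : sgraph) k (f : {ffun G -> 'I_k}) :
  nonrepetitive f -> star_colouring f.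
Proof.
move=> f_nonrep; split=> [x y xy|a b c d path_abcd [fac fbd]].
  apply/negP => /eqP fxy; apply: (f_nonrep 1 [tuple x; y]) => //.
    rewrite /is_path /= inE xy !andbT.
    by apply: contraTneq xy => ->; rewrite adj_irrefl.
  by move=> i; rewrite !(tnth_nth x) ord1.
apply: (f_nonrep 2 [tuple a; b; c; d]) => // i.
by rewrite !(tnth_nth a); case: i => -[|[|]].
Qed.

(** * Monotonicity in the number of colours *)

(** Raising [s] by one changes [(s - 1) * n - 'C(s, 2)] by [n - s], which is
    nonnegative as long as [s <= n]. *)
Lemma edge_bound_mono n s c :
  0 < s -> s <= c -> c <= n.+1 ->
  n * (s - 1) + 'C(c, 2) <= n * (c - 1) + 'C(s, 2).
Proof.
move=> s_gt0 /subnKC <-; elim: (c - s) => [|d IH] h; first by rewrite addn0.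
have := IH ltac:(lia); rewrite addnS binS bin1.
rewrite [in X in _ -> X](_ : (s + d).+1 - 1 = (s + d - 1).+1); last by lia.
rewrite mulnS; lia.
Qed.

(** * The extremal graph *)

Lemma bin2D k m : 'C(k + m, 2) + 'C(k.+1, 2) = k * (k + m) + 'C(m, 2).
Proof.
elim: k => [|k IH]; first by rewrite add0n mul0n addn0.
by rewrite addSn (binS (k + m)) (binS k.+1) !bin1; nia.
Qed.

Section Extremal.

Variables n k : nat.

Definition dom_adj : rel 'I_n :=
  fun x y => (x != y) && ((x < k) || (y < k)).

Lemma dom_adj_sym : symmetric dom_adj.
Proof. by move=> x y; rewrite /dom_adj eq_sym orbC. Qed.

Lemma dom_adj_irrefl : irreflexive dom_adj.
Proof. by move=> x; rewrite /dom_adj eqxx. Qed.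

Definition dom_graph : sgraph := SGraph dom_adj_sym dom_adj_irrefl.

Definition dom_colour : {ffun dom_graph -> 'I_k.+1} :=
  [ffun x : 'I_n => inord (minn x k)].

Lemma dom_colour_eq (x y : 'I_n) :
  dom_colour x = dom_colour y -> x != y -> k <= x.
Proof.
rewrite !ffunE => /(congr1 val); rewrite /= !inordK ?ltnS ?geq_minr //.
by move=> eq_min; rewrite -val_eqE /=; lia.
Qed.

Lemma dom_colour_nonrep : nonrepetitive dom_colour.
Proof.
move=> t p t_gt0 /andP[p_uniq p_sorted] p_rep.
have big (i : 'I_t) : k <= tnth p (lshift t i) /\ k <= tnth p (rshift t i).
  have neq : tnth p (lshift t i) != tnth p (rshift t i).
    by rewrite (inj_eq (tuple_uniqP p p_uniq)) eq_lrshift.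
  split; first exact: dom_colour_eq (p_rep i) neq.
  by apply: dom_colour_eq (esym (p_rep i)) _; rewrite eq_sym.
have all_big (j : 'I_(t + t)) : k <= tnth p j.
  by rewrite -(splitK j); case: (split j) => i /=; case: (big i).
have t2 : 1 < t + t by lia.
have x0 : dom_graph := tnth p (Ordinal t2).
have /(sortedP x0)/(_ 0) := p_sorted; rewrite size_tuple => /(_ t2).
have := all_big (Ordinal (ltnW t2)); have := all_big (Ordinal t2).
by rewrite !(tnth_nth x0) /= /dom_adj => h1 h0; rewrite !ltnNge h0 h1 andbF.
Qed.

(** Written as a difference of two families of pairs, the edge set is counted by
    two binomial coefficients. *)
Lemma dom_graph_edges :
  edges dom_graph =
  [set A : {set 'I_n} | #|A| == 2]
    :\: [set A : {set 'I_n} | A \subset [set x : 'I_n | k <= x] & #|A| == 2].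
Proof.
apply/setP => A; rewrite !inE; apply/existsP/idP.
  case=> x /existsP[y /andP[/andP[x_y xy_k] /eqP->]].
  rewrite cards2 x_y /= !andbT subUset !sub1set !inE.
  by rewrite negb_and -!ltnNge.
case/andP=> not_ind A2; move: not_ind; rewrite A2 andbT.
case/cards2P: A2 => x [y [x_y ->]]; rewrite subUset !sub1set !inE.
rewrite negb_and -!ltnNge => xy_k.
by exists x; apply/existsP; exists y; rewrite eqxx andbT /= /dom_adj x_y.
Qed.

Lemma card_independent : k <= n -> #|[set x : 'I_n | k <= x]| = n - k.
Proof.
move=> k_n; have lt_k : #|[pred x : 'I_n | x < k]| = k.
  rewrite -sum1_card; transitivity (\sum_(i < n | i < k) 1) => //.
  by rewrite (big_ord_narrow k_n) sum1_card card_ord.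
rewrite -[X in X - k]card_ord -(cardC [pred x : 'I_n | x < k]) lt_k addKn.
by rewrite cardsE; apply: eq_card => x; rewrite !inE -leqNgt.
Qed.

Lemma dom_graph_edges_card :
  k <= n -> #|edges dom_graph| = k * n - 'C(k.+1, 2).
Proof.
move=> k_n; rewrite dom_graph_edges cardsD (setIidPr _); last first.
  by apply/subsetP => A; rewrite !inE => /andP[].
rewrite cards_draws card_independent //.
have -> : #|[set A : {set 'I_n} | #|A| == 2]| = 'C(n, 2).
  rewrite -[X in 'C(X, 2)]card_ord -cardsT -cards_draws.
  by apply: eq_card => A; rewrite !inE subsetT.
have := leq_bin2l 2 (leq_subr k n); have := bin2D k (n - k).
by rewrite subnKC //; lia.
Qed.

End Extremal.

Theorem proposition5p1 (n c : nat) (hc : 0 < c) (hn : c <= n.+1) :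
  is_maximum
    (fun m : nat => exists G : sgraph,
       [/\ #|G| = n, nonrep_chi G <= c & #|edges G| = m])
    ((c - 1) * n - 'C(c, 2)).
Proof.
have [k ec] : exists k, c = k.+1 by exists c.-1; rewrite prednK.
split.
  subst c; exists (dom_graph n k).
  rewrite card_ord subn1 dom_graph_edges_card //; split=> //.
  rewrite /nonrep_chi; case: ex_minnP => m _; apply; apply/asboolP.
  by exists (dom_colour n k); apply: dom_colour_nonrep.
move=> m [G [nG chiG <-]]; move: chiG; rewrite /nonrep_chi.
case: ex_minnP => j /asboolP[f f_nonrep] _ j_c.
have := star_colouring_edges (nonrepetitive_star f_nonrep).
set s := #|f @: _|; rewrite nG => bound.
have s_c : s <= c by apply: leq_trans (max_card _) _; rewrite card_ord.
have [s0|s_gt0] := posnP s; first by move: bound; rewrite s0 muln0; lia.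
have := edge_bound_mono s_gt0 s_c hn; rewrite mulnC; lia.
Qed.
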